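(* Let $p$ be a prime and let $a\in\mathbb{Z}_p^\times$ not be a root of unity. Write $L_a:\mathbb{Q}_p\to\mathbb{Q}_p$ for $L_a(x)=ax$, and let $N(a)$ be the number of $\mathbb{Z}_p$-orbits of $L_a$ in $\mathbb{Z}_p^\times$. Let $\mathfrak{p}=p\mathbb{Z}_p$. (i) Suppose that $p\neq 2$ and $a=\zeta a_1$, where $a_1\in 1+\mathfrak{p}$ and $\zeta$ is a primitive $k$th root of unity with $p\nmid k$. Then $N(a)=\frac{1}{k}(p-1)p^{n-1}$, where $n=\operatorname{ord}_p(a_1-1)$. (ii) Suppose that $p=2$ and $a\in 1+\mathfrak{p}^2$. Then $N(a)=2^{n-1}$, where $n=\operatorname{ord}_2(a-1)$. (iii) Suppose that $p=2$ and $a\in(1+\mathfrak{p})-(1+\mathfrak{p}^2)$. Then $N(a)=2^{n-1}$, where $n=\operatorname{ord}_2(a+1)$. (iv) In all cases, the number of $\mathbb{Z}_p$-orbits of $L_a$ in each circle of constant norm $\{x\in\mathbb{Q}_p: |x|=p^{-i}\}$, $i\in\mathbb{Z}$, is exactly $N(a)$.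
   Context: The $\mathbb{Z}_p$-orbit of $x$ under $L_a$ is the closure in $\mathbb{Q}_p$ of $\{a^nx\mid n\in\mathbb{Z}_{\ge 0}\}$. $\operatorname{ord}_p$ is the $p$-adic valuation with $\operatorname{ord}_p(p)=1$. *)

(* Defs.v *)
From HB Require Import structures.
From mathcomp Require Import all_boot all_order all_algebra.
From mathcomp Require Import all_classical all_reals all_analysis.

Set Implicit Arguments.
Unset Strict Implicit.
Unset Printing Implicit Defensive.

Import Order.TTheory GRing.Theory Num.Theory.

Local Open Scope classical_set_scope.
Local Open Scope ring_scope.

(* Z_p is the inverse limit of the rings Z/p^(n+1), n >= 0, and Q_p is its
   fraction field.  The n-th component of x : padic_int is its residue modulo
   p^(n+1), so that every 'Z_(p ^ n.+1) really is Z/p^(n+1). *)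

Definition padic_coherent (p : nat) (x : forall n, 'Z_(p ^ n.+1)) : bool :=
  `[< forall n, x n.+1 = x n %[mod p ^ n.+1] >].

Record padic_int (p : nat) (p_pr : prime p) : Type := PadicInt {
  padic_res : forall n, 'Z_(p ^ n.+1);
  padic_resP : padic_coherent padic_res }.

Section PadicInt.
Variables (p : nat) (p_pr : prime p).
Local Notation padic_int := (padic_int p_pr).
Local Notation padic_res := (@padic_res p p_pr).
Local Notation PadicInt := (@PadicInt p p_pr _).

HB.instance Definition _ := [isSub for padic_res].
HB.instance Definition _ := gen_eqMixin padic_int.
HB.instance Definition _ := gen_choiceMixin padic_int.

Lemma padic_int_eqP (x y : padic_int) :
  (forall n, padic_res x n = padic_res y n) -> x = y.
Proof. by move=> xy; apply/val_inj/functional_extensionality_dep. Qed.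

Let expp_gt1 n : (1 < p ^ n.+1)%N.
Proof. by rewrite -(exp1n n.+1) ltn_exp2r// prime_gt1. Qed.

Let ZtruncE n : (Zp_trunc (p ^ n.+1)).+2 = (p ^ n.+1)%N.
Proof. exact: Zp_cast. Qed.

Let p_dvd n : (p ^ n.+1 %| p ^ n.+2)%N.
Proof. exact: dvdn_exp2l. Qed.

Lemma padic_res_coh (x : padic_int) n :
  padic_res x n.+1 = padic_res x n %[mod p ^ n.+1].
Proof. by case: x => x /= /asboolP. Qed.

Lemma val_ZD n (u v : 'Z_(p ^ n.+1)) :
  (u + v)%R = (u + v)%N %[mod p ^ n.+1].
Proof. by rewrite /= modn_dvdm// ZtruncE. Qed.

Lemma val_ZM n (u v : 'Z_(p ^ n.+1)) :
  (u * v)%R = (u * v)%N %[mod p ^ n.+1].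
Proof. by rewrite /= modn_dvdm// ZtruncE. Qed.

Lemma mod_weak n a b : a = b %[mod p ^ n.+2] -> a = b %[mod p ^ n.+1].
Proof.
by move=> ab; rewrite -(modn_dvdm a (p_dvd n)) ab modn_dvdm.
Qed.

Let zero_coh : padic_coherent (fun n => 0 : 'Z_(p ^ n.+1)).
Proof. by apply/asboolP. Qed.

Let one_coh : padic_coherent (fun n => 1 : 'Z_(p ^ n.+1)).
Proof. by apply/asboolP. Qed.

Let add_coh (x y : padic_int) :
  padic_coherent (fun n => padic_res x n + padic_res y n).
Proof.
apply/asboolP => n; rewrite val_ZD (mod_weak (val_ZD _ _)).
by rewrite -modnDm !padic_res_coh modnDm.
Qed.

Let mul_coh (x y : padic_int) :
  padic_coherent (fun n => padic_res x n * padic_res y n).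
Proof.
apply/asboolP => n; rewrite val_ZM (mod_weak (val_ZM _ _)).
by rewrite -modnMm !padic_res_coh modnMm.
Qed.

Let opp_coh (x : padic_int) : padic_coherent (fun n => - padic_res x n).
Proof.
apply/asboolP => n; apply/eqP; rewrite -(eqn_modDr (padic_res x n)).
rewrite -(val_ZD (- padic_res x n)) addNr.
rewrite -modnDmr -padic_res_coh modnDmr.
by rewrite -(mod_weak (val_ZD (- padic_res x n.+1) _)) addNr.
Qed.

Definition padic_int0 := PadicInt zero_coh.
Definition padic_int1 := PadicInt one_coh.
Definition padic_int_add x y := PadicInt (add_coh x y).
Definition padic_int_mul x y := PadicInt (mul_coh x y).
Definition padic_int_opp x := PadicInt (opp_coh x).

Fact padic_int_addA : associative padic_int_add.
Proof. by move=> x y z; apply: padic_int_eqP => n /=; rewrite addrA. Qed.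
Fact padic_int_addC : commutative padic_int_add.
Proof. by move=> x y; apply: padic_int_eqP => n /=; rewrite addrC. Qed.
Fact padic_int_add0 : left_id padic_int0 padic_int_add.
Proof. by move=> x; apply: padic_int_eqP => n /=; rewrite add0r. Qed.
Fact padic_int_addN : left_inverse padic_int0 padic_int_opp padic_int_add.
Proof. by move=> x; apply: padic_int_eqP => n /=; rewrite addNr. Qed.

HB.instance Definition _ := GRing.isZmodule.Build padic_int
  padic_int_addA padic_int_addC padic_int_add0 padic_int_addN.

Fact padic_int_mulA : associative padic_int_mul.
Proof. by move=> x y z; apply: padic_int_eqP => n /=; rewrite mulrA. Qed.
Fact padic_int_mulC : commutative padic_int_mul.
Proof. by move=> x y; apply: padic_int_eqP => n /=; rewrite mulrC. Qed.
Fact padic_int_mul1 : left_id padic_int1 padic_int_mul.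
Proof. by move=> x; apply: padic_int_eqP => n /=; rewrite mul1r. Qed.
Fact padic_int_mulDl : left_distributive padic_int_mul padic_int_add.
Proof. by move=> x y z; apply: padic_int_eqP => n /=; rewrite mulrDl. Qed.
Fact padic_int_1neq0 : padic_int1 != 0.
Proof. by apply/eqP => /(congr1 (fun x => padic_res x 0)). Qed.

HB.instance Definition _ := GRing.Zmodule_isComNzRing.Build padic_int
  padic_int_mulA padic_int_mulC padic_int_mul1 padic_int_mulDl padic_int_1neq0.

Definition padic_int_unit : pred padic_int :=
  fun x => `[< exists y : padic_int, y * x = 1 >].

Definition padic_int_inv (x : padic_int) : padic_int :=
  if pselect (exists y : padic_int, y * x = 1) is left h then projT1 (cid h)
  else x.

Fact padic_int_mulV : {in padic_int_unit, left_inverse 1 padic_int_inv *%R}.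
Proof.
move=> x /asboolP xu; rewrite /padic_int_inv.
by case: pselect => // h; case: (cid h).
Qed.
Fact padic_int_unitP (x y : padic_int) : y * x = 1 -> padic_int_unit x.
Proof. by move=> yx; apply/asboolP; exists y. Qed.
Fact padic_int_inv_out : {in [predC padic_int_unit], padic_int_inv =1 id}.
Proof.
move=> x; rewrite inE /= => /asboolPn xu; rewrite /padic_int_inv.
by case: pselect.
Qed.

HB.instance Definition _ := GRing.ComNzRing_hasMulInverse.Build padic_int
  padic_int_mulV padic_int_unitP padic_int_inv_out.

Lemma padic_resD (x y : padic_int) n :
  padic_res (x + y) n = padic_res x n + padic_res y n.
Proof. by []. Qed.

Lemma padic_resM (x y : padic_int) n :
  padic_res (x * y) n = padic_res x n * padic_res y n.
Proof. by []. Qed.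

Lemma padic_res_mod (x : padic_int) m n : (m <= n)%N ->
  padic_res x n = padic_res x m %[mod p ^ m.+1].
Proof.
move=> /subnK <-; elim: (n - m)%N => [|k IH]; first by [].
have d : (p ^ m.+1 %| p ^ (k + m).+1)%N by rewrite dvdn_exp2l// ltnS leq_addl.
rewrite -IH addSn -(modn_dvdm _ d) padic_res_coh modn_dvdm //.
Qed.

Lemma padic_res_eq0 (x : padic_int) m n : (m <= n)%N ->
  (padic_res x m == 0) = (p ^ m.+1 %| padic_res x n)%N.
Proof.
move=> mn; rewrite /dvdn (padic_res_mod _ mn) -val_eqE /= modn_small//.
by rewrite -[X in (_ < X)%N]ZtruncE ltn_ord.
Qed.

Lemma padic_int_neq0 (x : padic_int) :
  x != 0 -> exists n, padic_res x n != 0.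
Proof.
move=> x0; apply: contrapT => /forallNP h; move/eqP: x0; apply.
by apply: padic_int_eqP => n; have /negP/negPn/eqP := h n.
Qed.

(* ord_p on Z_p: the least n such that x is nonzero modulo p^(n+1).
   The value at x = 0, where ord_p is +oo, is the junk value 0. *)
Definition padic_int_ord (x : padic_int) : nat :=
  if pselect (exists n, padic_res x n != 0) is left h then ex_minn h else 0.

Lemma padic_int_ordP (x : padic_int) k : x != 0 ->
  (k <= padic_int_ord x)%N = [forall i : 'I_k, padic_res x i == 0].
Proof.
move=> /padic_int_neq0 x0; rewrite /padic_int_ord; case: pselect => // h.
case: ex_minnP => m xm mmin; apply/idP/forallP => [km i|kz].
  apply/negPn/negP => /mmin; rewrite leqNgt => /negP; apply.
  exact: leq_trans (ltn_ord i) km.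
by rewrite leqNgt; apply/negP => mk; have := kz (Ordinal mk); rewrite (negPf xm).
Qed.

Lemma padic_int_ord_dvd (x : padic_int) k n : x != 0 -> (k <= n.+1)%N ->
  (k <= padic_int_ord x)%N = (p ^ k %| padic_res x n)%N.
Proof.
move=> x0 kn; rewrite padic_int_ordP//; case: k kn => [|k] kn.
  by rewrite expn0 dvd1n; apply/forallP => -[].
rewrite -padic_res_eq0//; apply/forallP/idP => [/(_ ord_max)//|xk [i /= ik]].
rewrite (@padic_res_eq0 _ _ k)//; move: xk.
rewrite (@padic_res_eq0 _ _ k)//; apply: dvdn_trans.
exact: dvdn_exp2l.
Qed.

Lemma padic_int_ord_logn (x : padic_int) n : x != 0 ->
  (padic_int_ord x <= n)%N ->
  (0 < padic_res x n)%N /\ logn p (padic_res x n) = padic_int_ord x.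
Proof.
move=> x0 xn.
have H k : (k <= n.+1)%N -> _ := @padic_int_ord_dvd x k n x0.
have xgt0 : (0 < padic_res x n)%N.
  rewrite lt0n; apply/eqP => xn0.
  by have := H n.+1 (leqnn _); rewrite xn0 dvdn0 ltnNge xn.
split=> //; apply/eqP; rewrite eqn_leq -(pfactor_dvdn _ p_pr xgt0).
rewrite -H ?leqnn ?andbT//; last exact: leqW.
by rewrite leqNgt -(pfactor_dvdn _ p_pr xgt0) -H ?ltnn// ltnS.
Qed.

Lemma padic_int_mul_neq0 (x y : padic_int) : x != 0 -> y != 0 ->
  x * y != 0 /\
  padic_int_ord (x * y) = (padic_int_ord x + padic_int_ord y)%N.
Proof.
move=> x0 y0; set n := (padic_int_ord x + padic_int_ord y)%N.
have [xn lx] := padic_int_ord_logn x0 (leq_addr _ _ : (_ <= n)%N).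
have [yn ly] := padic_int_ord_logn y0 (leq_addl _ _ : (_ <= n)%N).
have dvdE k : (k <= n.+1)%N ->
    (p ^ k %| padic_res (x * y)%R n)%N = (k <= n)%N.
  move=> kn; have d : (p ^ k %| p ^ n.+1)%N by exact: dvdn_exp2l.
  rewrite /dvdn -(modn_dvdm _ d) padic_resM val_ZM modn_dvdm//.
  rewrite -/(p ^ k %| padic_res x n * padic_res y n)%N.
  by rewrite pfactor_dvdn ?muln_gt0 ?xn// lognM// lx ly.
have xy0 : x * y != 0.
  by apply/eqP => xy0; have := dvdE n.+1 (leqnn _); rewrite xy0 dvdn0 ltnn.
split=> //; apply/eqP; rewrite eqn_leq.
rewrite [X in _ && X](padic_int_ord_dvd xy0 (leqnSn n)) dvdE// leqnn andbT.
by rewrite leqNgt (padic_int_ord_dvd xy0 (leqnn n.+1)) dvdE// ltnn.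
Qed.

Lemma padic_int_ordD (x y : padic_int) k : x + y != 0 ->
  (x != 0 -> (k <= padic_int_ord x)%N) -> (y != 0 -> (k <= padic_int_ord y)%N) ->
  (k <= padic_int_ord (x + y)%R)%N.
Proof.
move=> xy0 hx hy.
have z (u : padic_int) : (u != 0 -> (k <= padic_int_ord u)%N) ->
    forall i : 'I_k, padic_res u i = 0.
  have [->//|u0 /(_ isT)] := eqVneq u 0.
  by rewrite padic_int_ordP// => /forallP ku i; apply/eqP.
by rewrite padic_int_ordP//; apply/forallP => i; rewrite padic_resD !z// addr0.
Qed.

Fact padic_int_idomain (x y : padic_int) : x * y = 0 -> (x == 0) || (y == 0).
Proof.
move=> xy0; apply: contraPT (xy0); rewrite negb_or => /andP[x0 y0].
by have [/eqP] := padic_int_mul_neq0 x0 y0.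
Qed.

HB.instance Definition _ :=
  GRing.ComUnitRing_isIntegral.Build padic_int padic_int_idomain.

End PadicInt.

Section Padic.
Variables (p : nat) (p_pr : prime p).
Local Notation Zp := (padic_int p_pr).

Local Notation num x := (frac (repr x)).1.
Local Notation den x := (frac (repr x)).2.

Definition padic : Type := {fraction Zp}.

(* Equality on {fraction Zp} is computed on chosen representatives, which makes
   conversion blow up; padic carries the same field operations over the
   classical eqType and choiceType structures. *)
HB.instance Definition _ := gen_eqMixin padic.
HB.instance Definition _ := gen_choiceMixin padic.
HB.instance Definition _ := GRing.isZmodule.Build padic
  (@addrA {fraction Zp}) (@addrC {fraction Zp}) (@add0r {fraction Zp})
  (@addNr {fraction Zp}).

Fact padic_1neq0 : (1 : {fraction Zp}) != 0 :> padic.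
Proof. by apply/eqP => e10; case/eqP: (oner_neq0 {fraction Zp}). Qed.

HB.instance Definition _ := GRing.Zmodule_isComNzRing.Build padic
  (@mulrA {fraction Zp}) (@mulrC {fraction Zp}) (@mul1r {fraction Zp})
  (@mulrDl {fraction Zp}) padic_1neq0.

Definition padic_inv (x : padic) : padic := (x : {fraction Zp})^-1.

Fact padic_mulV (x : padic) : x != 0 -> padic_inv x * x = 1.
Proof. by move=> /eqP x0; apply: (@mulVf {fraction Zp}); apply/eqP. Qed.

Fact padic_inv0 : padic_inv 0 = 0.
Proof. exact: (@invr0 {fraction Zp}). Qed.

HB.instance Definition _ :=
  GRing.ComNzRing_isField.Build padic padic_mulV padic_inv0.

Definition padic_of_int : Zp -> padic := @FracField.tofrac Zp.
HB.instance Definition _ := GRing.isZmodMorphism.Build Zp padic padic_of_int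
  (@tofrac_is_zmod_morphism Zp).
HB.instance Definition _ := GRing.isMonoidMorphism.Build Zp padic padic_of_int
  (@tofrac_is_monoid_morphism Zp).

Lemma padic_of_intM : {morph padic_of_int : u v / u * v}.
Proof. exact: rmorphM. Qed.
Lemma padic_of_intD : {morph padic_of_int : u v / u + v}.
Proof. exact: rmorphD. Qed.
Lemma padic_of_intN : {morph padic_of_int : u / - u}.
Proof. exact: rmorphN. Qed.

(* ord_p (u / v) = ord_p u - ord_p v on a representative fraction u / v; it does
   not depend on the fraction, see padic_ord_frac.  At x = 0, where ord_p is
   +oo, the value is junk. *)
Definition padic_ord (x : padic) : int :=
  (padic_int_ord (num x))%:Z - (padic_int_ord (den x))%:Z.

Definition padic_norm (x : padic) : rat :=
  if x == 0 then 0 else p%:R ^ (- padic_ord x).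

Lemma padic_of_int_eq0 (u : Zp) : (padic_of_int u == 0) = (u == 0).
Proof.
apply/eqP/eqP => [u0|->]; last exact: tofrac0.
by apply/eqP; rewrite -(tofrac_eq0 u); apply/eqP.
Qed.

Lemma padic_reprE (x : padic) :
  x * padic_of_int (den x) = padic_of_int (num x).
Proof.
suff : (x : {fraction Zp}) * FracField.tofrac (den x) = FracField.tofrac (num x).
  by [].
rewrite -[X in X * _]reprK; unlock FracField.tofrac.
rewrite -[LHS]FracField.pi_mul; apply/eqmodP.
rewrite /= FracField.equivfE /FracField.mulf /=.
rewrite !numden_Ratio ?mulf_neq0 ?oner_neq0 ?denom_ratioP//.
by rewrite !mulr1 mulrC.
Qed.

Lemma padic_ord_frac (x : padic) (u v : Zp) : u != 0 -> v != 0 ->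
  x * padic_of_int v = padic_of_int u ->
  padic_ord x = (padic_int_ord u)%:Z - (padic_int_ord v)%:Z.
Proof.
move=> u0 v0 xuv; rewrite /padic_ord.
have d0 : (den x) != 0 by exact: denom_ratioP.
have n0 : (num x) != 0.
  apply/eqP => n0; have := padic_reprE x; rewrite n0 rmorph0 => /eqP.
  rewrite mulf_eq0 padic_of_int_eq0 (negPf d0) orbF => /eqP x0.
  by move/eqP: xuv; rewrite x0 mul0r eq_sym padic_of_int_eq0 (negPf u0).
have e : (num x) * v = u * (den x).
  apply/eqP; rewrite -subr_eq0 -padic_of_int_eq0 padic_of_intD padic_of_intN !padic_of_intM subr_eq0.
  by rewrite -(padic_reprE x) -xuv mulrAC.
have [_ e1] := padic_int_mul_neq0 n0 v0.
have [_ e2] := padic_int_mul_neq0 u0 d0.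
apply/eqP; rewrite subr_eq addrAC eq_sym subr_eq -!PoszD eqz_nat.
by rewrite -e1 e e2.
Qed.

Let pgt0 : 0 < p%:R :> rat.
Proof. by rewrite ltr0n prime_gt0. Qed.

Let pgt1 : 1 < p%:R :> rat.
Proof. by rewrite ltr1n prime_gt1. Qed.

Lemma padic_norm_ge0 (x : padic) : 0 <= padic_norm x.
Proof. by rewrite /padic_norm; case: ifP => // _; rewrite exprz_ge0// ltW. Qed.

Lemma padic_norm0 : padic_norm 0 = 0.
Proof. by rewrite /padic_norm eqxx. Qed.

Lemma padic_normN (x : padic) : padic_norm (- x) = padic_norm x.
Proof.
rewrite /padic_norm oppr_eq0; case: eqVneq => // x0; congr (_ ^ (- _)).
have d0 : (den x) != 0 by exact: denom_ratioP.
have n0 : (num x) != 0.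
  apply/eqP => n0; have := padic_reprE x; rewrite n0 rmorph0 => /eqP.
  by rewrite mulf_eq0 padic_of_int_eq0 (negPf d0) orbF (negPf x0).
have m10 : (-1 : Zp) != 0 by rewrite oppr_eq0 oner_neq0.
have [nn0 e] := padic_int_mul_neq0 m10 n0.
have o1 : padic_int_ord (-1 : Zp) = 0%N.
  have [_ /eqP] := padic_int_mul_neq0 (oner_neq0 Zp) (oner_neq0 Zp).
  rewrite mulr1 -[X in X == _]addn0 eqn_add2l => /eqP o10.
  have [_ /esym/eqP] := padic_int_mul_neq0 m10 m10.
  by rewrite mulrNN mulr1 -o10 addn_eq0 andbb => /eqP.
rewrite (padic_ord_frac nn0 d0); first by rewrite e o1 add0n.
by rewrite mulNr padic_reprE mulN1r padic_of_intN.
Qed.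

Lemma padic_norm_ultra (x y : padic) :
  padic_norm (x + y) <= Num.max (padic_norm x) (padic_norm y).
Proof.
have [->|x0] := eqVneq x 0; first by rewrite add0r le_max lexx orbT.
have [->|y0] := eqVneq y 0; first by rewrite addr0 le_max lexx.
have [xy0|xy0] := eqVneq (x + y) 0.
  by rewrite xy0 padic_norm0 le_max padic_norm_ge0.
have dx0 : (den x) != 0 by exact: denom_ratioP.
have dy0 : (den y) != 0 by exact: denom_ratioP.
pose d := (den x) * (den y).
pose u := (num x) * (den y); pose v := (num y) * (den x).
have d0 : d != 0 by rewrite mulf_neq0.
have xd : x * padic_of_int d = padic_of_int u.
  by rewrite !padic_of_intM mulrA padic_reprE.
have yd : y * padic_of_int d = padic_of_int v.
  by rewrite !padic_of_intM mulrCA mulrC padic_reprE.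
have D0 : padic_of_int d != 0 by rewrite padic_of_int_eq0.
have u0 : u != 0 by rewrite -(padic_of_int_eq0 u) -xd; exact: mulf_neq0.
have v0 : v != 0 by rewrite -(padic_of_int_eq0 v) -yd; exact: mulf_neq0.
have xyd : (x + y) * padic_of_int d = padic_of_int (u + v).
  by rewrite mulrDl xd yd padic_of_intD.
have uv0 : u + v != 0.
  by rewrite -(padic_of_int_eq0 (u + v)) -xyd; exact: mulf_neq0.
rewrite /padic_norm (negPf x0) (negPf y0) (negPf xy0) le_max.
rewrite !(ler_eXz2l pgt1) !lerN2.
rewrite (padic_ord_frac uv0 d0 xyd) (padic_ord_frac u0 d0 xd).
rewrite (padic_ord_frac v0 d0 yd) !lerD2r !lez_nat.
have [uv|vu] := leqP (padic_int_ord u) (padic_int_ord v).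
  by apply/orP; left; apply: padic_int_ordD.
by apply/orP; right; apply: padic_int_ordD => // _; apply: ltnW.
Qed.

Fact padic_ball_center (x : padic) (e : rat) :
  0 < e -> ball_ padic_norm x e x.
Proof. by rewrite /= subrr padic_norm0. Qed.

Fact padic_ball_sym (x y : padic) (e : rat) :
  ball_ padic_norm x e y -> ball_ padic_norm y e x.
Proof. by rewrite /= -padic_normN opprB. Qed.

Fact padic_ball_triangle (x y z : padic) (e1 e2 : rat) :
  ball_ padic_norm x e1 y -> ball_ padic_norm y e2 z ->
  ball_ padic_norm x (e1 + e2) z.
Proof.
rewrite /= => xy yz; rewrite -(subrKA y) (le_lt_trans (padic_norm_ultra _ _))//.
have e10 := le_lt_trans (padic_norm_ge0 _) xy.
have e20 := le_lt_trans (padic_norm_ge0 _) yz.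
by rewrite gt_max (lt_le_trans xy) ?(lt_le_trans yz) ?lerDl ?lerDr// ltW.
Qed.

HB.instance Definition _ :=
  hasNbhs.Build padic (nbhs_ball_ (ball_ padic_norm)).

Fact padic_nbhsE :
  nbhs = nbhs_ (entourage_ (ball_ padic_norm)) :> (padic -> _).
Proof.
apply/funext => x; rewrite predeqE => A; split.
  move=> [e e0 sA]; exists [set xy | ball_ padic_norm xy.1 e xy.2].
    by exists e.
  by move=> y /xsectionP; exact: sA.
move=> [E [e e0 sE] EA]; exists e => // y xy; exact/EA/xsectionP/sE.
Qed.

(* The p-adic topology: the library's [closure] on Q_p refers to |x - y|_p. *)
HB.instance Definition _ := Nbhs_isPseudoMetric.Build rat padic
  padic_nbhsE padic_ball_center padic_ball_sym padic_ball_triangle erefl.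

Definition padic_units : set padic :=
  [set padic_of_int u | u in [set u : Zp | u \is a GRing.unit]].

Definition one_plus_pideal (j : nat) : set padic :=
  [set 1 + padic_of_int (p%:R ^+ j * z) | z in [set: Zp]].

Definition padic_circle (i : int) : set padic :=
  [set x | padic_norm x = p%:R ^ (- i)].

Definition Zp_orbit (a x : padic) : set padic :=
  closure [set a ^+ n * x | n in [set: nat]].

Definition Zp_orbits (a : padic) (S : set padic) : set (set padic) :=
  [set Zp_orbit a x | x in S].

End Padic.

Arguments padic_units {p p_pr}.
Arguments one_plus_pideal {p p_pr} j.
Arguments padic_circle {p p_pr} i.

(* Main.v *)
(* Let b = a^d = 1 + p^n c with c a unit (and n >= 2 if p = 2).  Then b^(p^r)
   is 1 + p^(n+r) times a unit, so the powers of b approximate every element of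
   1 + p^n Z_p digit by digit.  Hence the orbit closure of a unit x is the set
   of units congruent modulo p^n to some a^k x, the orbits in Z_p^* are the
   cosets of <a mod p^n> in (Z/p^n)^*, and N(a) times the order of a modulo p^n
   is the totient of p^n.  In cases (i) and (ii) take n = ord_p(a1 - 1), where a
   has order k modulo p^n; in case (iii) take d = 2, which gives the exponent
   ord_2(a + 1) + 1, modulo which a has order 2.  Multiplication by p^i carries
   the orbits in Z_p^* to those in the circle of norm p^-i. *)

Require Import Defs.
From HB Require Import structures.
From mathcomp Require Import all_boot all_order all_fingroup all_algebra.
From mathcomp Require Import cyclic.
From mathcomp Require Import all_classical all_reals all_analysis.
From mathcomp Require Import ring.

Set Implicit Arguments.
Unset Strict Implicit.
Unset Printing Implicit Defensive.

Import Order.TTheory GRing.Theory Num.Theory.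

Local Open Scope classical_set_scope.
Local Open Scope card_scope.
Local Open Scope ring_scope.

(** * Residues, units and divisibility by powers of p in Z_p *)

Section PadicIntTheory.
Variables (p : nat) (p_pr : prime p).
Local Notation Zp := (padic_int p_pr).
Implicit Types (u v w : Zp) (m n k : nat).

Let q_gt1 n : (1 < p ^ n.+1)%N.
Proof. by rewrite -(exp1n n.+1) ltn_exp2r// prime_gt1. Qed.

Let p_gt0 : (0 < p)%N := prime_gt0 p_pr.

Lemma Zp_nat_eq q (s t : nat) : (1 < q)%N ->
  (s%:R == t%:R :> 'Z_q) = (s == t %[mod q]).
Proof. by move=> q1; rewrite -val_eqE /= !val_Zp_nat. Qed.

(** The modulus index comes first so that reduction at a fixed level can carry a ring morphism
    structure. *)
Definition padic_mod n u : 'Z_(p ^ n.+1) := padic_res u n.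
Arguments padic_mod : simpl never.

Fact padic_mod_zmod n : zmod_morphism (padic_mod n).
Proof. by []. Qed.
Fact padic_mod_monoid n : monoid_morphism (padic_mod n).
Proof. by []. Qed.

HB.instance Definition _ n :=
  GRing.isZmodMorphism.Build Zp 'Z_(p ^ n.+1) (padic_mod n) (padic_mod_zmod n).
HB.instance Definition _ n :=
  GRing.isMonoidMorphism.Build Zp 'Z_(p ^ n.+1) (padic_mod n)
    (padic_mod_monoid n).

Lemma padic_mod_pX n w : padic_mod n (p%:R ^+ n.+1 * w) = 0.
Proof.
by rewrite rmorphM rmorphXn rmorph_nat -natrX pchar_Zp// mul0r.
Qed.

(** The quotient is built residue by residue. Dividing by p^(n+1) loses n+1 digits, so its residue
    at level k is taken from [u] at level k+n+1. Multiplying by p^(n+1) turns its coherence into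
    that of [u]. *)
Lemma padic_mod_eq0 n u : padic_mod n u = 0 -> exists w, u = p%:R ^+ n.+1 * w.
Proof.
move=> u0.
have dvdu k : (p ^ n.+1 %| padic_res u (k + n.+1))%N.
  rewrite -padic_res_eq0; first by apply/eqP.
  by rewrite addnS ltnW// ltnS leq_addl.
pose s k := (padic_res u (k + n.+1) %/ p ^ n.+1)%N.
have sE k : (p ^ n.+1 * s k)%N = padic_res u (k + n.+1).
  by rewrite mulnC divnK.
have coh : padic_coherent (fun k => (s k)%:R : 'Z_(p ^ k.+1)).
  apply/asboolP => k; rewrite !val_Zp_nat// modn_mod modn_dvdm ?dvdn_exp2l//.
  have c0 : (0 < p ^ n.+1)%N by rewrite expn_gt0 p_gt0.
  apply/eqP; rewrite -(eqn_pmul2l c0) !muln_modr !sE.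
  rewrite (_ : p ^ n.+1 * p ^ k.+1 = p ^ (k + n.+1).+1)%N.
    by rewrite [X in X == _]padic_res_coh.
  by rewrite -expnD addnC.
exists (PadicInt p_pr coh); apply: padic_int_eqP => k.
rewrite -[RHS]/(padic_mod k (_ * _)) rmorphM rmorphXn rmorph_nat -natrX.
rewrite -[X in _ * X]/((s k)%:R) -natrM sE.
rewrite -[LHS]natr_Zp; apply/eqP; rewrite Zp_nat_eq//.
by rewrite (@padic_res_mod _ _ u k) ?leq_addr.
Qed.

Lemma padic_modE n u v :
  padic_mod n u = padic_mod n v <-> exists w, u = v + p%:R ^+ n.+1 * w.
Proof.
split=> [uv|[w ->]]; last by rewrite rmorphD /= padic_mod_pX addr0.
have [|w e] := @padic_mod_eq0 n (u - v); first by rewrite rmorphB /= uv subrr.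
by exists w; rewrite -e addrC subrK.
Qed.

Lemma padic_mod_one_unitX n w j :
  padic_mod n ((1 + p%:R ^+ n.+1 * w) ^+ j) = 1.
Proof.
by rewrite rmorphXn rmorphD /= padic_mod_pX rmorph1 addr0 expr1n.
Qed.

Lemma padic_mod_surj n (t : 'Z_(p ^ n.+1)) : exists u, padic_mod n u = t.
Proof. by exists (t : nat)%:R; rewrite rmorph_nat natr_Zp. Qed.

(** A residue prime to p is invertible modulo every power of p. These inverses are coherent because
    inverses modulo p^(n+1) are unique. *)
Lemma padic_intP_unit u : reflect (padic_mod 0 u != 0) (u \is a GRing.unit).
Proof.
apply: (iffP idP) => [uU|u0].
  apply/eqP => u0; have : padic_mod 0 (u / u) != 0 by rewrite divrr// rmorph1.
  by rewrite rmorphM /= u0 mul0r eqxx.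
have resU n : padic_res u n \is a GRing.unit.
  rewrite -[padic_res u n]natr_Zp unitZpE// coprime_pexpl// prime_coprime//.
  by rewrite -[X in (X %| _)%N]expn1 -(padic_res_eq0 u (leq0n n)).
have coh : padic_coherent (fun n => (padic_res u n)^-1).
  apply/asboolP => n; set X := _^-1; set Y := _^-1.
  have XA : (X * padic_res u n.+1)%N = 1 %[mod p ^ n.+1].
    by apply: mod_weak; rewrite -(val_ZM p_pr) /X mulVr ?resU.
  have YB : (padic_res u n * Y)%N = 1 %[mod p ^ n.+1].
    by rewrite -(val_ZM p_pr) /Y mulrV ?resU.
  apply/eqP; rewrite -Zp_nat_eq//; apply/eqP.
  move/eqP: XA; rewrite -Zp_nat_eq// natrM => /eqP XA.
  move/eqP: YB; rewrite -Zp_nat_eq// natrM => /eqP YB.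
  have /eqP := padic_res_coh u n; rewrite -Zp_nat_eq// => /eqP AB.
  rewrite -[LHS]mulr1 -[X in _ * X]YB -AB mulrA XA; exact: mul1r.
apply/unitrP; exists (PadicInt p_pr coh); split; apply: padic_int_eqP => n.
  by rewrite padic_resM /= mulVr ?resU.
by rewrite padic_resM /= mulrV ?resU.
Qed.

Lemma padic_int_unit1D u : (1 + p%:R * u) \is a GRing.unit.
Proof.
apply/padic_intP_unit; rewrite -[p%:R]expr1 rmorphD /= padic_mod_pX addr0.
by rewrite rmorph1 oner_neq0.
Qed.

Lemma padic_mod_unit n u :
  (padic_mod n u \is a GRing.unit) = (u \is a GRing.unit).
Proof.
apply/idP/idP => [uU|]; last exact: rmorph_unit.
apply/padic_intP_unit; rewrite (padic_res_eq0 u (leq0n n)) expn1.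
by rewrite -prime_coprime// -(coprime_pexpl (k := n.+1))// -unitZpE// natr_Zp.
Qed.

Lemma padic_int_pnat_neq0 : p%:R != 0 :> Zp.
Proof.
apply/eqP => p0; have := congr1 (padic_mod 1) p0.
rewrite rmorph_nat rmorph0 => /eqP; rewrite (@Zp_nat_eq _ p 0)// mod0n.
move=> /(dvdn_leq p_gt0); rewrite -[X in (_ <= X)%N]expn1.
by rewrite leq_exp2l// prime_gt1.
Qed.

Lemma padic_int_pX_neq0 k : p%:R ^+ k != 0 :> Zp.
Proof. by rewrite expf_neq0// padic_int_pnat_neq0. Qed.

Lemma padic_int_pNunit w : p%:R * w \is a GRing.unit -> False.
Proof.
by move/padic_intP_unit; rewrite -[p%:R]expr1 padic_mod_pX eqxx.
Qed.

Lemma padic_int_unit_or_dvdp u : u \is a GRing.unit \/ exists w, u = p%:R * w.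
Proof.
have [/eqP u0|u0] := boolP (padic_mod 0 u == 0).
  by have [w] := padic_mod_eq0 u0; right; exists w.
by left; apply/padic_intP_unit.
Qed.

Lemma padic_int_ord_ge k u : u != 0 ->
  (k <= padic_int_ord u)%N <-> exists w, u = p%:R ^+ k * w.
Proof.
case: k => [|k] u0; first by split=> // _; exists u; rewrite expr0 mul1r.
rewrite (padic_int_ord_dvd u0 (leqnn _)) -padic_res_eq0//.
split=> [/eqP/padic_mod_eq0//|[w ->]].
by rewrite -/(padic_mod k _) padic_mod_pX.
Qed.

Lemma padic_int_ord_pX k w : w \is a GRing.unit ->
  padic_int_ord (p%:R ^+ k * w) = k.
Proof.
move=> wU; have w0 : w != 0 by apply: contraTneq wU => ->; rewrite unitr0.
have n0 : p%:R ^+ k * w != 0 by rewrite mulf_neq0 ?padic_int_pX_neq0.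
apply/eqP; rewrite eqn_leq; apply/andP; split; last first.
  by apply/padic_int_ord_ge => //; exists w.
rewrite leqNgt; apply/negP => /(padic_int_ord_ge _ n0)[v].
rewrite exprSr -mulrA => /(mulfI (padic_int_pX_neq0 k)) e.
by apply: (@padic_int_pNunit v); rewrite -e.
Qed.

Lemma padic_int_ord_unit w : w \is a GRing.unit -> padic_int_ord w = 0%N.
Proof. by move=> /(padic_int_ord_pX 0); rewrite mul1r. Qed.

(** If the cofactor were divisible by p, the valuation of [u] would exceed itself. *)
Lemma padic_int_decomp u : u != 0 ->
  exists2 w, w \is a GRing.unit & u = p%:R ^+ padic_int_ord u * w.
Proof.
move=> u0; have [w e] := (padic_int_ord_ge (padic_int_ord u) u0).1 (leqnn _).
have [wU|[v wv]] := padic_int_unit_or_dvdp w; first by exists w.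
have : (padic_int_ord u < padic_int_ord u)%N.
  by apply/(padic_int_ord_ge _ u0); exists v; rewrite exprSr -mulrA -wv.
by rewrite ltnn.
Qed.

End PadicIntTheory.

(** * Valuation, norm and closure in Q_p *)

Section PadicTheory.
Variables (p : nat) (p_pr : prime p).
Local Notation Zp := (padic_int p_pr).
Local Notation Qp := (padic p_pr).
Implicit Types (u v w : Zp) (x y : Qp) (k : nat) (i j : int).

Let p_gt1 : (1 < p%:R :> rat).
Proof. by rewrite ltr1n prime_gt1. Qed.

Let p_gt0 : (0 < p%:R :> rat).
Proof. by rewrite ltr0n prime_gt0. Qed.

Lemma padic_of_int_inj : injective (@padic_of_int p p_pr).
Proof.
move=> u v /eqP; rewrite -subr_eq0 -padic_of_intN -padic_of_intD.
by rewrite padic_of_int_eq0 subr_eq0 => /eqP.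
Qed.

Lemma padic_of_int_pX k : padic_of_int (p%:R ^+ k) = p%:R ^+ k :> Qp.
Proof. by rewrite rmorphXn rmorph_nat. Qed.

Lemma padic_pnat_neq0 : p%:R != 0 :> Qp.
Proof.
by rewrite -[p%:R]expr1 -padic_of_int_pX padic_of_int_eq0 padic_int_pX_neq0.
Qed.

Lemma padic_of_int_unit_neq0 w : w \is a GRing.unit -> padic_of_int w != 0.
Proof.
by move=> wU; rewrite padic_of_int_eq0; apply: contraTneq wU => ->; rewrite unitr0.
Qed.

Lemma padic_of_intV w : w \is a GRing.unit ->
  padic_of_int w^-1 = (padic_of_int w)^-1 :> Qp.
Proof.
move=> wU; apply: (mulfI (padic_of_int_unit_neq0 wU)).
by rewrite -padic_of_intM !divrr ?rmorph1 ?unitfE ?padic_of_int_unit_neq0.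
Qed.

Lemma padic_ord_pX i w : w \is a GRing.unit ->
  padic_ord (p%:R ^ i * padic_of_int w : Qp) = i.
Proof.
move=> wU; have w0 : w != 0 by rewrite -padic_of_int_eq0 padic_of_int_unit_neq0.
have P0 k := padic_int_pX_neq0 p_pr k.
case: i => k.
  rewrite -exprnP -padic_of_int_pX -padic_of_intM.
  rewrite (@padic_ord_frac _ _ _ (p%:R ^+ k * w) 1) ?mulf_neq0 ?oner_neq0//.
    by rewrite padic_int_ord_pX// padic_int_ord_unit ?unitr1// subr0.
  by rewrite rmorph1 mulr1.
rewrite NegzE -exprnN.
rewrite (@padic_ord_frac _ _ _ w (p%:R ^+ k.+1)) ?w0 ?P0//.
  rewrite padic_int_ord_unit// -[X in padic_int_ord X]mulr1.
  by rewrite padic_int_ord_pX ?unitr1 ?sub0r.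
rewrite padic_of_int_pX mulrAC mulVf ?mul1r// expf_neq0//.
exact: padic_pnat_neq0.
Qed.

(** Numerator and denominator of a representative fraction are each a power of p times a unit, and
    the quotient of the two units is a unit. *)
Lemma padic_decomp x : x != 0 ->
  exists2 w, w \is a GRing.unit & x = p%:R ^ padic_ord x * padic_of_int w.
Proof.
move=> x0; have e := padic_reprE x.
set d := (frac (generic_quotient.repr x)).2 in e.
set n := (frac (generic_quotient.repr x)).1 in e.
have d0 : d != 0 by exact: denom_ratioP.
have D0 : padic_of_int d != 0 by rewrite padic_of_int_eq0.
have n0 : n != 0 by rewrite -padic_of_int_eq0 -e mulf_neq0.
have [v vU vE] := padic_int_decomp d0; have [u uU uE] := padic_int_decomp n0.
have wU : u / v \is a GRing.unit by rewrite unitrM uU unitrV.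
suff xE : x = p%:R ^ ((padic_int_ord n)%:Z - (padic_int_ord d)%:Z)
    * padic_of_int (u / v).
  by exists (u / v) => //; rewrite [in padic_ord _]xE padic_ord_pX.
have p0 := padic_pnat_neq0.
apply: (mulIf D0); rewrite e [in LHS]uE [in X in _ = _ * padic_of_int X]vE.
rewrite !padic_of_intM !padic_of_int_pX padic_of_intV// expfzDr// -exprnN.
have aux (F : fieldType) (A B C D : F) : B != 0 -> D != 0 ->
  A * B^-1 * (C * D^-1) * (B * D) = A * C by move=> b0 e0; field; rewrite b0 e0.
rewrite [RHS]aux ?expf_neq0//.
by rewrite padic_of_int_unit_neq0.
Qed.

Lemma padic_norm_pX i w : w \is a GRing.unit ->
  padic_norm (p%:R ^ i * padic_of_int w : Qp) = p%:R ^ (- i).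
Proof.
move=> wU; rewrite /padic_norm padic_ord_pX// mulf_eq0 expfz_eq0.
by rewrite (negPf padic_pnat_neq0) andbF (negPf (padic_of_int_unit_neq0 wU)).
Qed.

Lemma padic_normM_pX i x : padic_norm (p%:R ^ i * x) = p%:R ^ (- i) * padic_norm x.
Proof.
have [->|x0] := eqVneq x 0; first by rewrite mulr0 padic_norm0 mulr0.
have [w wU ->] := padic_decomp x0; set j := padic_ord x.
rewrite mulrA -expfzDr ?padic_pnat_neq0// !padic_norm_pX// opprD expfzDr//.
by rewrite gt_eqF.
Qed.

(** Translates closeness in the norm into congruence modulo p^k, which links orbit closures to
    residues. *)
Lemma padic_norm_le k x :
  padic_norm x <= p%:R ^- k <-> exists w, x = padic_of_int (p%:R ^+ k * w).
Proof.
have [->|x0] := eqVneq x 0.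
  by split=> [_|_]; [exists 0; rewrite mulr0 rmorph0|
    rewrite padic_norm0 invr_ge0 exprn_ge0// ltW].
have [v vU xE] := padic_decomp x0; split=> [|[w xw]].
  rewrite xE padic_norm_pX// exprnN ler_eXz2l// lerN2.
  case: (padic_ord x) => // m; rewrite lez_nat => km.
  exists (p%:R ^+ (m - k) * v).
  by rewrite mulrA -exprD subnKC// padic_of_intM padic_of_int_pX.
have w0 : w != 0.
  by apply: contraNneq x0 => w0; rewrite xw w0 mulr0 rmorph0.
have [u uU uE] := padic_int_decomp w0.
have -> : x = p%:R ^ (k + padic_int_ord w)%:Z * padic_of_int u.
  rewrite xw uE mulrA -exprD padic_of_intM padic_of_int_pX {1}uE.
  by rewrite padic_int_ord_pX.
by rewrite padic_norm_pX// exprnN ler_eXz2l// lerN2 lez_nat leq_addr.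
Qed.

Lemma padic_ord_of_int u : u != 0 ->
  padic_ord (padic_of_int u) = padic_int_ord u.
Proof.
move=> u0; rewrite (@padic_ord_frac _ _ _ u 1) ?oner_neq0//.
  by rewrite (@padic_int_ord_unit _ _ 1) ?unitr1// subr0.
by rewrite rmorph1 mulr1.
Qed.

Lemma padic_unit_norm x : padic_units x <-> padic_norm x = 1.
Proof.
split=> [[u uU <-]|x1].
  by rewrite -[padic_of_int u]mul1r -(expr0z p%:R) padic_norm_pX.
have x0 : x != 0.
  by apply: contra_eq_neq x1 => ->; rewrite padic_norm0 eq_sym oner_neq0.
have [w wU xE] := padic_decomp x0; move: x1; rewrite xE padic_norm_pX// -xE.
rewrite -[RHS](expr0z p%:R) => /(ieexprIz p_gt0 _)/eqP.
rewrite gt_eqF// oppr_eq0 => /(_ isT)/eqP ox.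
by exists w => //; rewrite xE ox expr0z mul1r.
Qed.

Lemma padic_closureP (A : set Qp) x :
  closure A x <-> forall e : rat, 0 < e -> exists2 y, A y & padic_norm (x - y) < e.
Proof.
split=> [clx e e0|h B].
  have [y [Ay xy]] := clx _ (nbhsx_ballx x e e0).
  by exists y.
move=> [e /= e0 eB]; have [y Ay xy] := h e e0.
by exists y; split=> //; exact: eB.
Qed.

Lemma padic_pX_lt (e : rat) : 0 < e -> exists k, p%:R ^- k < e.
Proof.
move=> e0; exists (Num.bound e^-1).
rewrite -[ltRHS]invrK ltf_pV2 ?posrE ?exprn_gt0 ?invr_gt0//.
apply: (lt_trans (archi_boundP _)); first by rewrite invr_ge0 ltW.
rewrite -natrX ltr_nat; exact: ltn_expl (prime_gt1 p_pr).
Qed.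

End PadicTheory.

(** * Powers of elements of 1 + p^n Z_p *)

Lemma exprD1_mod_sqr (R : comNzRingType) (x : R) n :
  exists s, (1 + x) ^+ n = 1 + n%:R * x + x ^+ 2 * s.
Proof.
elim: n => [|n [s IH]]; first by exists 0; rewrite expr0; ring.
by exists (n%:R + s + x * s); rewrite exprS IH -natr1; ring.
Qed.

(** This geometric sum is the cofactor of b - 1 in b^n - 1 for b = 1 + x. The linear coefficient is
    0 + 1 + ... + (n-1). *)
Lemma sum_exprD1_mod_sqr (R : comNzRingType) (x : R) n :
  exists s, \sum_(i < n) (1 + x) ^+ i = n%:R + 'C(n, 2)%:R * x + x ^+ 2 * s.
Proof.
elim: n => [|n [s IH]]; first by exists 0; rewrite big_ord0 bin0n /=; ring.
have [s' e] := exprD1_mod_sqr x n.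
by exists (s + s'); rewrite big_ord_recr /= IH e binS bin1 natrD -natr1; ring.
Qed.

Section OneUnits.
Variables (p : nat) (p_pr : prime p).
Local Notation Zp := (padic_int p_pr).
Implicit Types (b c w z : Zp) (k n r : nat).

(** For k > 0 this makes 'C(p, 2) p^k divisible by p^2: an odd p divides 'C(p, 2), while for p = 2
    the power p^k already suffices. *)
Let p_odd_or_sqr k := p <> 2 \/ (1 < k)%N.

(** With b = 1 + x, b^p - 1 is x times the sum of the b^i for i < p. That sum is p modulo p^2, that
    is p times a unit, so the valuation rises by exactly one. *)
Lemma padic_one_unitXp k c : (0 < k)%N -> p_odd_or_sqr k ->
  c \is a GRing.unit ->
  exists2 c', c' \is a GRing.unit &
    (1 + p%:R ^+ k * c) ^+ p = 1 + p%:R ^+ k.+1 * c'.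
Proof.
case: k => // k _ pk cU; set x := p%:R ^+ k.+1 * c.
have [t tE] : exists t, 'C(p, 2)%:R * x = p%:R ^+ 2 * t.
  have [p2|pn2] := eqVneq p 2%N.
    case: pk => // k1; case: k @x k1 => // k x _.
    by exists ('C(p, 2)%:R * (p%:R ^+ k * c)); rewrite /x !exprS; ring.
  have p_gt2 : (2 < p)%N by rewrite ltn_neqAle eq_sym pn2 prime_gt1.
  have /dvdnP[m ->] := prime_dvd_bin p_pr (p_gt2 : 0 < 2 < p)%N.
  by exists (m%:R * (p%:R ^+ k * c)); rewrite /x !exprS natrM; ring.
have [s sE] : exists s, \sum_(i < p) (1 + x) ^+ i = p%:R * (1 + p%:R * s).
  have [s sE] := sum_exprD1_mod_sqr x p.
  exists (t + p%:R ^+ (k + k) * c ^+ 2 * s); rewrite sE tE /x (exprS _ k).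
  by rewrite exprD; ring.
exists (c * (1 + p%:R * s)); first by rewrite unitrM cU padic_int_unit1D.
rewrite -[LHS](subrK 1) subrX1 addrC sE [1 + x]addrC addrK /x !exprS; ring.
Qed.

Lemma padic_one_unitXpX n r c : (0 < n)%N -> p_odd_or_sqr n ->
  c \is a GRing.unit ->
  exists2 c', c' \is a GRing.unit &
    (1 + p%:R ^+ n * c) ^+ (p ^ r) = 1 + p%:R ^+ (n + r) * c'.
Proof.
move=> n0 pn cU; elim: r => [|r [c' c'U IH]].
  by exists c => //; rewrite addn0.
rewrite expnSr exprM IH addnS; apply: padic_one_unitXp => //.
  by rewrite addn_gt0 n0.
by case: pn => pn; [left | right; exact: leq_trans pn (leq_addr _ _)].
Qed.

(** Induction on the precision r, with b = 1 + p^n c. If b^j has error p^(n+r) w, a further factor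
    b^(p^r t), which is 1 + t c' p^(n+r) to first order, removes the leading digit of the error for
    a suitable t. *)
Lemma padic_one_unit_dense n c : (0 < n)%N -> p_odd_or_sqr n ->
  c \is a GRing.unit ->
  forall z r, exists j w,
    1 + p%:R ^+ n * z = (1 + p%:R ^+ n * c) ^+ j + p%:R ^+ (n + r) * w.
Proof.
move=> n0 pn cU z; elim=> [|r [j [w IH]]].
  by exists 0%N, z; rewrite expr0 addn0.
have [c' c'U bE] := padic_one_unitXpX r n0 pn cU.
(* The exponent t is the residue of w / c' modulo p, available since c' is a unit. *)
have [t [w' wE]] : exists (t : nat) w', w = c' * t%:R + p%:R * w'.
  pose t : nat := padic_mod 0 (w / c').
  have /padic_modE[v vE] : padic_mod 0 (w / c') = padic_mod 0 (t%:R : Zp).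
    by rewrite rmorph_nat natr_Zp.
  exists t, (c' * v).
  rewrite expr1 in vE; rewrite -[LHS](divrK c'U) vE; ring.
(* As b^j is 1 modulo p^n, multiplying the correction by it changes it only by a multiple of
   p^(2n+r). *)
have [h hE] : exists h, (1 + p%:R ^+ n * c) ^+ j = 1 + p%:R ^+ n * h.
  have [s ->] := exprD1_mod_sqr (p%:R ^+ n * c) j.
  by exists (j%:R * c + p%:R ^+ n * c ^+ 2 * s); ring.
have [s sE] := exprD1_mod_sqr (p%:R ^+ (n + r) * c') t.
exists (j + p ^ r * t)%N.
(* The exponents with [n.-1] remain when p^(n+r+1) is taken out of p^(2n+r) and p^(2n+2r). *)
exists (w' - p%:R ^+ n.-1 * h * t%:R * c'
  - p%:R ^+ (n.-1 + r) * (1 + p%:R ^+ n * h) * c' ^+ 2 * s).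
rewrite exprD exprM bE sE IH hE wE addnS.
by case: n {IH pn bE hE sE} n0 => // n _; rewrite addSn /= !exprS; ring.
Qed.

End OneUnits.

(** * Orbits as cosets in the units modulo p^(m+1) *)

Lemma card_eq_finset (T : finType) (x0 : T) (A : {set T}) :
  [set` A] #= `I_#|A|.
Proof.
have -> : [set` A] = nth x0 (enum A) @` `I_#|A|.
  apply/seteqP; split=> [x xA|x [i /= iA <-]].
    exists (index x (enum A)); last by rewrite nth_index ?mem_enum.
    by rewrite /= cardE index_mem mem_enum.
  by rewrite -(mem_enum (mem A)) mem_nth -?cardE.
apply: inj_card_eq => i j; rewrite !inE /= cardE => iA jA /eqP.
by rewrite nth_uniq ?enum_uniq// => /eqP.
Qed.

Section OrbitCount.
Variables (p : nat) (p_pr : prime p) (m : nat) (alpha : padic_int p_pr).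
Hypothesis alphaU : alpha \is a GRing.unit.
Hypothesis alpha_dense : forall z r, exists j w,
  1 + p%:R ^+ m.+1 * z = alpha ^+ j + p%:R ^+ (m.+1 + r) * w.
Local Notation Zp := (padic_int p_pr).
Local Notation Qp := (padic p_pr).
Local Notation a := (padic_of_int alpha : Qp).
Implicit Types (xi eta : Zp).

(** A limit of points of the orbit agrees with one of them modulo p^(m+1). Conversely, if eta is
    congruent to alpha^k xi, then eta / (alpha^k xi) lies in 1 + p^(m+1) Z_p, where [alpha_dense]
    approximates it by powers of alpha. *)
Lemma Zp_orbit_mod xi : xi \is a GRing.unit ->
  Zp_orbit a (padic_of_int xi) =
  [set padic_of_int eta | eta in [set eta | eta \is a GRing.unit /\
     exists k, padic_mod m eta = padic_mod m (alpha ^+ k * xi)]].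
Proof.
move=> xiU; have akU k : alpha ^+ k * xi \is a GRing.unit.
  by rewrite unitrM xiU unitrX.
have akE k : a ^+ k * padic_of_int xi = padic_of_int (alpha ^+ k * xi).
  by rewrite padic_of_intM rmorphXn.
apply/seteqP; split=> y.
  move=> /padic_closureP /(_ (p%:R ^- m.+1)) [].
    by rewrite invr_gt0 exprn_gt0// ltr0n prime_gt0.
  move=> _ [k _ <-] /ltW /padic_norm_le[w].
  rewrite akE => /eqP; rewrite subr_eq addrC -padic_of_intD => /eqP yE.
  exists (alpha ^+ k * xi + p%:R ^+ m.+1 * w) => //=.
  have e : padic_mod m (alpha ^+ k * xi + p%:R ^+ m.+1 * w)
    = padic_mod m (alpha ^+ k * xi) by apply/padic_modE; exists w.
  by split; [rewrite -(padic_mod_unit m) e padic_mod_unit | exists k].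
move=> [eta [etaU [k /padic_modE[w etaE]]] <-].
apply/padic_closureP => e /(padic_pX_lt p_pr)[r re].
have [j [w' jE]] := alpha_dense (w / (alpha ^+ k * xi)) r.
exists (a ^+ (j + k) * padic_of_int xi); first by exists (j + k)%N.
(* The error is divisible even by p^(m+1+r); divisibility by p^r is enough here. *)
apply: le_lt_trans re; apply/padic_norm_le.
exists (p%:R ^+ m.+1 * w' * (alpha ^+ k * xi)).
rewrite akE -padic_of_intN -padic_of_intD; congr padic_of_int.
apply/eqP; rewrite subr_eq; apply/eqP.
have -> : eta = (1 + p%:R ^+ m.+1 * (w / (alpha ^+ k * xi))) * (alpha ^+ k * xi).
  by rewrite mulrDl mul1r -mulrA divrK.
rewrite jE !exprD; ring.
Qed.

(** Non-units are sent to the default value 1, which is why [P] below asks separately that xi be a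
    unit. *)
Let unit_mod xi : {unit 'Z_(p ^ m.+1)} :=
  insubd (1%g : {unit 'Z_(p ^ m.+1)}) (padic_mod m xi).

Let val_unit_mod xi : xi \is a GRing.unit ->
  val (unit_mod xi) = padic_mod m xi.
Proof. by move=> xiU; rewrite val_insubd padic_mod_unit xiU. Qed.

Let unit_mod_surj g : exists2 xi, xi \is a GRing.unit & unit_mod xi = g.
Proof.
have [xi xiE] := padic_mod_surj p_pr (val g).
have xiU : xi \is a GRing.unit by rewrite -(padic_mod_unit m) xiE; exact: valP.
by exists xi => //; apply: val_inj; rewrite val_unit_mod.
Qed.

Let P (A : {set {unit 'Z_(p ^ m.+1)}}) : set Qp :=
  [set padic_of_int xi | xi in [set xi | xi \is a GRing.unit /\ unit_mod xi \in A]].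

(** Reduction is onto the finite unit group, so a set of residues is recovered from its preimage.
    Counting orbits thus becomes counting cosets. *)
Let P_inj : injective P.
Proof.
move=> A B AB; apply/setP => g; have [xi xiU <-] := unit_mod_surj g.
have PE (C : {set {unit 'Z_(p ^ m.+1)}}) :
    (unit_mod xi \in C) <-> P C (padic_of_int xi).
  split=> [xiC|[eta [_ etaC] /padic_of_int_inj <-//]].
  by exists xi.
by apply/idP/idP => /PE; [rewrite AB|rewrite -AB] => /PE.
Qed.

Let H := <[unit_mod alpha]>%G.

Let Zp_orbitE xi : xi \is a GRing.unit ->
  Zp_orbit a (padic_of_int xi) = P (H :* unit_mod xi)%g.
Proof.
move=> xiU; rewrite Zp_orbit_mod//; congr image; apply/seteqP.
have vE k : val (unit_mod alpha ^+ k * unit_mod xi)%g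
    = padic_mod m (alpha ^+ k * xi).
  by rewrite FinRing.val_unitM FinRing.val_unitX !val_unit_mod// rmorphM rmorphXn.
split=> eta [etaU].
  move=> [k ek]; split=> //; apply/rcosetP.
  exists (unit_mod alpha ^+ k)%g; first exact: mem_cycle.
  by apply: val_inj; rewrite vE val_unit_mod.
move=> /rcosetP[_ /cycleP[k ->] e]; split=> //; exists k.
by rewrite -vE -e val_unit_mod.
Qed.

(** N is the index of the cyclic group [H], and the product formula is Lagrange's theorem. The order
    o is characterised by its multiples, the form in which each case can determine it. *)
Lemma Zp_orbits_card : exists N, Zp_orbits a padic_units #= `I_N /\
  forall o, (forall j, (padic_mod m (alpha ^+ j) == 1) = (o %| j)%N) ->
  (N * o)%N = totient (p ^ m.+1).
Proof.
exists #|rcosets H (units_Zp (p ^ m.+1))|; split.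
  have -> : Zp_orbits a padic_units
      = P @` [set` rcosets H (units_Zp (p ^ m.+1))].
    apply/seteqP; split=> [_ [_ [xi xiU <-] <-]|_ [_ /rcosetsP[g _ ->] <-]].
      exists (H :* unit_mod xi)%g; last by rewrite Zp_orbitE.
      by apply/rcosetsP; exists (unit_mod xi) => //; rewrite inE.
    have [xi xiU <-] := unit_mod_surj g.
    by exists (padic_of_int xi); [exists xi | rewrite Zp_orbitE].
  apply: card_eq_trans (card_eq_finset (gval H) _).
  by apply: inj_card_eq => A B _ _; exact: P_inj.
move=> o oE; rewrite -card_units_Zp ?expn_gt0 ?prime_gt0//.
rewrite -(Lagrange (finset.subsetT H)) mulnC; congr (_ * _)%N.
apply/eqP; rewrite -[#|H|]/(#[unit_mod alpha]%g) eqn_dvd.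
have ordE j : (#[unit_mod alpha]%g %| j)%N = (o %| j)%N.
  rewrite order_dvdn -oE -val_eqE FinRing.val_unitX val_unit_mod//.
  by rewrite -rmorphXn.
by rewrite -ordE dvdnn ordE dvdnn.
Qed.

End OrbitCount.

(** * Transport of orbits between circles by powers of p *)

Section Scaling.
Variables (p : nat) (p_pr : prime p).
Local Notation Qp := (padic p_pr).
Implicit Types (a x y : Qp) (i : int).

Lemma Zp_orbit_pM a x y i : Zp_orbit a x y ->
  Zp_orbit a (p%:R ^ i * x) (p%:R ^ i * y).
Proof.
have pi_gt0 : 0 < p%:R ^ i :> rat by rewrite exprz_gt0// ltr0n prime_gt0.
move=> /padic_closureP xy; apply/padic_closureP => e e0.
have [_ [n _ <-] yn] := xy (e * p%:R ^ i) (mulr_gt0 e0 pi_gt0).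
exists (a ^+ n * (p%:R ^ i * x)); first by exists n.
by rewrite mulrCA -mulrBr padic_normM_pX -invr_expz mulrC ltr_pdivrMr.
Qed.

Let pXK i : cancel ( *%R (p%:R ^ (- i))) ( *%R (p%:R ^ i : Qp)).
Proof.
by move=> x; rewrite mulrA -invr_expz divff ?mul1r// expfz_neq0// padic_pnat_neq0.
Qed.

(** The converse inclusion is [Zp_orbit_pM] for the inverse scaling by p^(-i). *)
Lemma Zp_orbit_pME a x i :
  Zp_orbit a (p%:R ^ i * x) = ( *%R (p%:R ^ i)) @` Zp_orbit a x.
Proof.
apply/seteqP; split=> [y xy|_ [y xy <-]]; last exact: Zp_orbit_pM.
exists (p%:R ^ (- i) * y); last exact: pXK.
by rewrite -[x](pXK (- i)) opprK; apply: Zp_orbit_pM.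
Qed.

Lemma padic_circleE i :
  padic_circle i = ( *%R (p%:R ^ i)) @` (padic_units : set Qp).
Proof.
have pi0 : p%:R ^ i != 0 :> rat by rewrite expfz_neq0// pnatr_eq0 -lt0n prime_gt0.
apply/seteqP; split=> [x xi|_ [x /padic_unit_norm x1 <-]]; last first.
  by rewrite /padic_circle/= padic_normM_pX x1 mulr1.
exists (p%:R ^ (- i) * x); last exact: pXK.
by apply/padic_unit_norm; rewrite padic_normM_pX opprK xi -invr_expz mulfV.
Qed.

Lemma card_Zp_orbits_circle a i :
  Zp_orbits a (padic_circle i) #= Zp_orbits a (padic_units : set Qp).
Proof.
have -> : Zp_orbits a (padic_circle i)
    = image^~ ( *%R (p%:R ^ i)) @` Zp_orbits a (padic_units : set Qp).
  rewrite padic_circleE; apply/seteqP; split.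
    move=> _ [_ [x xU <-] <-]; exists (Zp_orbit a x); first by exists x.
    by rewrite Zp_orbit_pME.
  move=> _ [_ [x xU <-] <-]; exists (p%:R ^ i * x); first by exists x.
  by rewrite Zp_orbit_pME.
apply: inj_card_eq => A B _ _ AB.
have pi0 : p%:R ^ i != 0 :> Qp by rewrite expfz_neq0// padic_pnat_neq0.
have sub (C D : set Qp) :
    *%R (p%:R ^ i) @` C = *%R (p%:R ^ i) @` D -> C `<=` D.
  move=> CD x Cx; have : ( *%R (p%:R ^ i) @` D) (p%:R ^ i * x).
    by rewrite -CD; exists x.
  by move=> [y Dy /(mulfI pi0) <-].
by apply/seteqP; split; apply: sub.
Qed.

End Scaling.

(** * Counting orbits when some power of alpha is close to 1 *)

Section OrbitCounts.
Variables (p : nat) (p_pr : prime p).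
Local Notation Zp := (padic_int p_pr).
Implicit Types (alpha c u w : Zp).

Lemma padic_int_unitDpM u w : u \is a GRing.unit ->
  u + p%:R * w \is a GRing.unit.
Proof.
move=> uU; have -> : u + p%:R * w = (1 + p%:R * (w / u)) * u.
  by rewrite mulrDl mul1r -mulrA divrK.
by rewrite unitrM uU padic_int_unit1D.
Qed.

Lemma padic_int_unit_nat k : ~~ (p %| k)%N -> (k%:R : Zp) \is a GRing.unit.
Proof.
move=> pk; apply/padic_intP_unit; rewrite rmorph_nat.
rewrite (@Zp_nat_eq _ k 0) ?expn1 ?prime_gt1//.
by rewrite mod0n.
Qed.

(** Powers of alpha^d are powers of alpha, so the density proved for alpha^d passes to alpha. *)
Lemma card_Zp_orbits_pow alpha d m c :
  alpha \is a GRing.unit -> c \is a GRing.unit -> p <> 2%N \/ (0 < m)%N ->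
  alpha ^+ d = 1 + p%:R ^+ m.+1 * c ->
  exists N, Zp_orbits (padic_of_int alpha) padic_units #= `I_N /\
  forall o, (forall j, (padic_mod m (alpha ^+ j) == 1) = (o %| j)%N) ->
  (N * o)%N = totient (p ^ m.+1).
Proof.
move=> alphaU cU pm adE; apply: Zp_orbits_card => // z r.
have [j [w ->]] := @padic_one_unit_dense _ p_pr m.+1 c isT pm cU z r.
by exists (d * j)%N, w; rewrite exprM adE.
Qed.

(** Provides a single N for all cases. Euler's theorem gives alpha^d = 1 + p^2 w; the modulus p^2,
    rather than p, also covers p = 2. Since alpha is not a root of unity, w is nonzero and has a
    finite valuation. *)
Lemma finite_Zp_orbits alpha : alpha \is a GRing.unit ->
  (forall n, (0 < n)%N -> alpha ^+ n != 1) ->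
  exists N, Zp_orbits (padic_of_int alpha) padic_units #= `I_N.
Proof.
move=> alphaU anr; have p2_gt1 : (1 < p ^ 2)%N by rewrite (ltn_exp2l 0) ?prime_gt1.
pose d := totient (p ^ 2).
have [w wE] : exists w, alpha ^+ d = 1 + p%:R ^+ 2 * w.
  apply/padic_modE; rewrite rmorph1 rmorphXn /=.
  rewrite -[padic_mod 1 alpha]natr_Zp -natrX; apply/eqP.
  rewrite (@Zp_nat_eq _ _ 1)//; apply/eqP/Euler_exp_totient.
  by rewrite coprime_sym -unitZpE// natr_Zp padic_mod_unit.
have w0 : w != 0.
  have d0 : (0 < d)%N by rewrite totient_gt0 expn_gt0 prime_gt0.
  by apply: contra_neq (anr _ d0) => w0; rewrite wE w0 mulr0 addr0.
have [c cU cE] := padic_int_decomp w0.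
(* The exponent of p in alpha^d - 1 is the valuation of w plus 2, and [m] is one less. *)
have [||N [NE _]] := @card_Zp_orbits_pow alpha d (padic_int_ord w).+1 c alphaU cU.
- by right.
- by rewrite wE {1}cE mulrA -exprD.
by exists N.
Qed.

End OrbitCounts.

(** * The order of alpha modulo the relevant power of p *)

Section Cases.
Variables (p : nat) (p_pr : prime p).
Local Notation Zp := (padic_int p_pr).
Implicit Types (alpha c u w zeta : Zp).

Lemma one_plus_pidealP j x : one_plus_pideal j x <->
  exists z : Zp, x = padic_of_int (1 + p%:R ^+ j * z).
Proof.
split=> [[z _ <-]|[z ->]]; last by exists z => //; rewrite padic_of_intD rmorph1.
by exists z; rewrite padic_of_intD rmorph1.
Qed.

Lemma padic_of_intB1 u : padic_of_int (1 + u) - 1 = padic_of_int u :> padic p_pr.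
Proof. by rewrite padic_of_intD rmorph1 addrAC subrr add0r. Qed.

Lemma padic_of_int_prim_root k w :
  k.-primitive_root (padic_of_int w) = k.-primitive_root w.
Proof.
congr (_ && _); apply: eq_forallb => i; rewrite !unity_rootE -rmorphXn.
rewrite -[1 in LHS](rmorph1 (@padic_of_int p p_pr)).
by rewrite (inj_eq (@padic_of_int_inj p p_pr)).
Qed.

(** Serves (i), and (ii) with zeta = 1. The power alpha^k is 1 + p^n c' with c' congruent to k c
    modulo p, a unit because p does not divide k. Modulo p^n, alpha equals zeta, whose order there
    is still k. *)
Lemma card_Zp_orbits_tors alpha zeta n c k N :
  p <> 2%N \/ (1 < n)%N -> (0 < n)%N -> c \is a GRing.unit ->
  k.-primitive_root zeta -> ~~ (p %| k)%N ->
  alpha = zeta * (1 + p%:R ^+ n * c) ->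
  Zp_orbits (padic_of_int alpha) padic_units #= `I_N ->
  (N * k)%N = totient (p ^ n).
Proof.
case: n => // m pm _ cU zk pk aE NE.
have kU := padic_int_unit_nat p_pr pk.
have zk1 := prim_expr_order zk.
have zU : zeta \is a GRing.unit.
  by rewrite -(unitrX_pos _ (prim_order_gt0 zk)) zk1 unitr1.
have alphaU : alpha \is a GRing.unit.
  by rewrite aE unitrM zU exprS -mulrA padic_int_unit1D.
have [s sE] := exprD1_mod_sqr (p%:R ^+ m.+1 * c) k.
pose c' := k%:R * c + p%:R * (p%:R ^+ m * c ^+ 2 * s).
have c'U : c' \is a GRing.unit by rewrite padic_int_unitDpM// unitrM kU.
have [|N' [N'E N'k]] := @card_Zp_orbits_pow _ p_pr alpha k m c' alphaU c'U pm.
  by rewrite aE exprMn zk1 mul1r sE /c' !exprS; ring.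
have -> : N = N' by apply/card_eq_II/(card_eq_trans _ N'E); rewrite card_eq_sym.
apply: N'k => j; rewrite (prim_order_dvd zk).
have -> : padic_mod m (alpha ^+ j) = padic_mod m (zeta ^+ j).
  by rewrite aE exprMn rmorphM /= padic_mod_one_unitX mulr1.
apply/eqP/eqP => [|->]; last by rewrite rmorph1.
rewrite -(rmorph1 (padic_mod m)) => /padic_modE[w zE].
pose x := p%:R ^+ m.+1 * w.
(* Since p does not divide k, the only kth root of unity congruent to 1 is 1. *)
have [t tE] := sum_exprD1_mod_sqr x k.
have : (zeta ^+ j - 1) * \sum_(i < k) (zeta ^+ j) ^+ i = 0.
  by rewrite -subrX1 exprAC zk1 expr1n subrr.
(* As zeta^j is 1 modulo p, this sum is k modulo p; being a unit, it forces zeta^j - 1 = 0. *)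
have sumU : \sum_(i < k) (zeta ^+ j) ^+ i \is a GRing.unit.
  rewrite zE tE /x -addrA.
  rewrite [X in _ + X](_ : _ = p%:R * ('C(k, 2)%:R * p%:R ^+ m * w
    + p%:R * p%:R ^+ m ^+ 2 * w ^+ 2 * t)); first exact: padic_int_unitDpM.
  by rewrite exprS; ring.
by move=> /(canRL (mulrK sumU)); rewrite mul0r => /subr0_eq.
Qed.

End Cases.

(** Squaring gives 1 + 2^(n+1) (- c + 2^(n-1) c^2), whose last factor is a unit since n > 1. So
    alpha has order dividing 2 modulo 2^(n+1), and it is not 1 there. *)
Lemma card_Zp_orbits_dyadic (p_pr : prime 2) (alpha c : padic_int p_pr) n N :
  (1 < n)%N -> c \is a GRing.unit -> alpha = -1 + 2%:R ^+ n * c ->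
  Zp_orbits (padic_of_int alpha) padic_units #= `I_N ->
  (N * 2)%N = totient (2 ^ n.+1).
Proof.
case: n => [//|[//|n _]] cU aE NE.
have alphaU : alpha \is a GRing.unit.
  by rewrite aE exprS -mulrA padic_int_unitDpM// unitrN1.
pose c' := - c + 2%:R * (2%:R ^+ n * c ^+ 2).
have c'U : c' \is a GRing.unit by rewrite padic_int_unitDpM// unitrN.
have a2E : alpha ^+ 2 = 1 + 2%:R ^+ n.+3 * c'.
  by rewrite aE /c' !exprS; ring.
have [|N' [N'E N'k]] :=
  @card_Zp_orbits_pow _ p_pr alpha 2 n.+2 c' alphaU c'U _ a2E; first by right.
have -> : N = N' by apply/card_eq_II/(card_eq_trans _ N'E); rewrite card_eq_sym.
apply: N'k => j; rewrite dvdn2.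
have -> : padic_mod n.+2 (alpha ^+ j) = padic_mod n.+2 (alpha ^+ odd j).
  rewrite -{1}(odd_double_half j) exprD -mul2n exprM a2E rmorphM /=.
  by rewrite padic_mod_one_unitX mulr1.
case: (odd j); last by rewrite expr0 rmorph1 eqxx.
apply/negP => /eqP; rewrite -(rmorph1 (padic_mod n.+2)) => /padic_modE[w].
rewrite expr1 aE => e.
(* Both sides are alpha + 1; cancelling one factor 2 equates a unit with an even element. *)
have e2 : 2%:R * (1 + 2%:R * (2%:R ^+ n.+1 * w))
    = 2%:R * (2%:R * (2%:R ^+ n * c)) :> padic_int p_pr.
  transitivity (1 + 2%:R ^+ n.+3 * w + 1 : padic_int p_pr).
    by rewrite !exprS; ring.
  by rewrite -e !exprS; ring.
apply: (@padic_int_pNunit _ p_pr (2%:R ^+ n * c)).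
rewrite -(mulfI (padic_int_pnat_neq0 p_pr) e2).
exact: padic_int_unit1D.
Qed.

(** * Assembly of the four claims *)

Lemma prim_root1 (R : nzRingType) : 1.-primitive_root (1 : R).
Proof.
by apply/andP; split=> //; apply/forallP => i; rewrite ord1 unity_rootE expr1n !eqxx.
Qed.

Lemma natr_totient_exp2 n : (0 < n)%N ->
  (totient (2 ^ n))%:R = 2%:R ^ (n%:Z - 1) :> rat.
Proof.
case: n => // n _; rewrite totient_pfactor// mul1n natrX.
by rewrite intS addrAC subrr add0r -exprnP.
Qed.

Theorem corollary7p4 (p : nat) (p_pr : prime p) (a : padic p_pr)
    (a_unit : padic_units a)
    (a_not_root : forall m : nat, (0 < m)%N -> ~~ m.-unity_root a) :
  exists N : nat,
    Zp_orbits a padic_units #= `I_N /\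
    (p <> 2%N ->
      forall (k : nat) (zeta a1 : padic p_pr),
        one_plus_pideal 1 a1 -> k.-primitive_root zeta ->
        ~~ (p %| k)%N -> a = zeta * a1 ->
        N%:R = k%:R^-1 * (p%:R - 1) * p%:R ^ (padic_ord (a1 - 1) - 1) :> rat) /\
    (p = 2%N -> one_plus_pideal 2 a ->
      N%:R = 2%:R ^ (padic_ord (a - 1) - 1) :> rat) /\
    (p = 2%N -> (one_plus_pideal 1 `\` one_plus_pideal 2) a ->
      N%:R = 2%:R ^ (padic_ord (a + 1) - 1) :> rat) /\
    (forall i : int, Zp_orbits a (padic_circle i) #= `I_N).
Proof.
case: a_unit => alpha alphaU aE; rewrite -{}aE in a_not_root *.
have alpha_nr n : (0 < n)%N -> alpha ^+ n != 1.
  move=> /a_not_root; apply: contra => /eqP an1.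
  by apply/unity_rootP; rewrite -rmorphXn an1 rmorph1.
have [N NE] := finite_Zp_orbits alphaU alpha_nr.
exists N; split=> //; split; last split; last split.
- move=> p2 k zeta _ /one_plus_pidealP[z ->] zk pk azE.
  set alpha1 := 1 + p%:R ^+ 1 * z in azE *.
  have a1U : alpha1 \is a GRing.unit by exact: padic_int_unit1D.
  (* The root of unity is given in Q_p; as a / a1 with a1 a unit, it comes from Z_p. *)
  have zetaE : zeta = padic_of_int (alpha / alpha1).
    apply: (mulIf (padic_of_int_unit_neq0 a1U)).
    by rewrite -padic_of_intM divrK.
  have zk' : k.-primitive_root (alpha / alpha1).
    by rewrite zetaE padic_of_int_prim_root in zk.
  (* If a1 were 1, then a = zeta would be a root of unity. *)
  have z0 : z != 0.
    apply: contra_neq (alpha_nr k (prim_order_gt0 zk)) => z0.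
    have := prim_expr_order zk'.
    by rewrite /alpha1 z0 mulr0 addr0 divr1.
  set u := p%:R ^+ 1 * z in alpha1 a1U zetaE zk' azE *.
  have u0 : u != 0 by rewrite mulf_neq0// padic_int_pX_neq0.
  have n0 : (0 < padic_int_ord u)%N by apply/padic_int_ord_ge => //; exists z.
  have [c cU cE] := padic_int_decomp u0.
  have := @card_Zp_orbits_tors _ p_pr alpha (alpha / alpha1) _ c k N
    (or_introl p2) n0 cU zk' pk.
  rewrite -cE divrK// => /(_ erefl NE) Nk.
  rewrite padic_of_intB1 padic_ord_of_int//.
  case: (padic_int_ord u) n0 Nk => // n _ Nk.
  rewrite intS addrAC subrr add0r.
  have k0 : k%:R != 0 :> rat by rewrite pnatr_eq0 -lt0n (prim_order_gt0 zk).
  apply: (mulIf k0); rewrite -natrM Nk totient_pfactor// natrM.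
  rewrite -subn1 natrB ?prime_gt0// natrX -exprnP /=.
  by field.
- move=> p2; subst p => /one_plus_pidealP[z /padic_of_int_inj].
  set u := 2%:R ^+ 2 * z => alphaE.
  have u0 : u != 0.
    by apply: contra_neq (alpha_nr 1%N isT) => u0; rewrite expr1 alphaE u0 addr0.
  have n1 : (1 < padic_int_ord u)%N by apply/padic_int_ord_ge => //; exists z.
  have [c cU cE] := padic_int_decomp u0.
  (* Here a itself is the one-unit, with trivial root of unity and k = 1. *)
  have := @card_Zp_orbits_tors _ p_pr alpha 1 _ c 1 N
    (or_intror n1) (ltnW n1) cU (prim_root1 _) isT.
  rewrite -cE mul1r => /(_ alphaE NE).
  rewrite alphaE padic_of_intB1 padic_ord_of_int//.
  by rewrite muln1 => ->; exact: natr_totient_exp2 (ltnW n1).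
- move=> p2; subst p => -[/one_plus_pidealP[z /padic_of_int_inj alphaE] z2].
  set u := alpha + 1.
  (* An even z would put alpha in 1 + 4 Z_2. *)
  have zU : z \is a GRing.unit.
    have [//|[w zw]] := padic_int_unit_or_dvdp z; case: z2.
    by apply/one_plus_pidealP; exists w; rewrite alphaE zw mulrA.
  have [w zE] : exists w, z = 1 + 2%:R ^+ 1 * w.
    apply/padic_modE; rewrite rmorph1; apply: val_inj.
    by move/padic_intP_unit: zU; case: (padic_mod 0 z) => [[|[|k]]].
  (* Since z is odd, alpha is 3 modulo 4, so alpha + 1 has valuation at least 2, as
     [card_Zp_orbits_dyadic] requires. *)
  have uE : u = 2%:R ^+ 2 * (1 + w) by rewrite /u alphaE zE; ring.
  have u0 : u != 0.
    apply: contra_neq (alpha_nr 2%N isT) => /eqP.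
    by rewrite addr_eq0 => /eqP ->; rewrite sqrrN expr1n.
  have n1 : (1 < padic_int_ord u)%N.
    by apply/padic_int_ord_ge => //; exists (1 + w).
  have [c cU cE] := padic_int_decomp u0.
  have N2 := card_Zp_orbits_dyadic n1 cU _ NE.
  have -> : padic_of_int alpha + 1 = padic_of_int u.
    by rewrite padic_of_intD rmorph1.
  rewrite padic_ord_of_int//.
  rewrite -natr_totient_exp2 ?(ltnW n1)//; congr _%:R; apply/eqP.
  (* The totient doubles from 2^n to 2^(n+1), which absorbs the order 2 of alpha. *)
  rewrite -(eqn_pmul2r (isT : 0 < 2)%N) N2 -?cE ?[-1 + _]addrC ?addrK//.
  by rewrite !totient_pfactor// ?(ltnW n1)// !mul1n -expnSr prednK// ltnW.
- by move=> i; apply: card_eq_trans (card_Zp_orbits_circle _ _) NE.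
Qed.
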